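(* $\xi_5=5$.
   Context: $Q_n=[0,1]^n\subset\mathbb{R}^n$. For a nondegenerate $n$-dimensional simplex $S\subset\mathbb{R}^n$ and $\sigma>0$, $\sigma S$ denotes the image of $S$ under the homothety with center at the center of gravity of $S$ (the arithmetic mean of its vertices) and coefficient $\sigma$. Put $\xi(S)=\min\{\sigma\ge 1: Q_n\subset\sigma S\}$, and $$\xi_n=\min\{\xi(S): S \text{ is an } n\text{-dimensional simplex},\ S\subset Q_n,\ \mathrm{vol}(S)\neq 0\}.$$ *)

(* Defs.v *)
From HB Require Import structures.
From mathcomp Require Import all_boot all_order all_algebra.
From mathcomp Require Import all_classical all_reals all_analysis.

Set Implicit Arguments.
Unset Strict Implicit.
Unset Printing Implicit Defensive.

Import Order.TTheory GRing.Theory Num.Theory.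
Import numFieldNormedType.Exports.

Local Open Scope classical_set_scope.
Local Open Scope ring_scope.

(* The least element of A, and 0 when A has none. A positive value of xi_n
   below cannot come from this default: it is an attained minimum, and it
   forces every admissible v to have xi v > 0, hence xi v to be attained too. *)
Definition set_min (R : realType) (A : set R) : R := xget 0 (A `&` lbound A).

Definition unit_cube (R : realType) (n : nat) : set 'rV[R]_n :=
  [set x | forall i, 0 <= x ord0 i <= 1].
Arguments unit_cube : clear implicits.

(* An n-dimensional simplex is given by its n + 1 vertices v, which are
   required to be affinely independent. *)
Definition affinely_independent (R : realType) (n : nat)
    (v : 'I_n.+1 -> 'rV[R]_n) : Prop :=
  forall a : 'I_n.+1 -> R,
    \sum_i a i = 0 -> \sum_i a i *: v i = 0 -> forall i, a i = 0.

Definition simplex (R : realType) (n : nat) (v : 'I_n.+1 -> 'rV[R]_n) :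
    set 'rV[R]_n :=
  [set x | exists t : 'I_n.+1 -> R,
    [/\ forall i, 0 <= t i, \sum_i t i = 1 & x = \sum_i t i *: v i]].

(* n-dimensional Lebesgue measure (of a Borel set), as the integral of the
   measures of its slices with fixed first coordinate, as in product_measure1;
   the measure on R^0 is the unit mass. *)
Fixpoint volume (R : realType) (n : nat) : set 'rV[R]_n -> \bar R :=
  match n return set 'rV[R]_n -> \bar R with
  | 0 => fun A => (\1_A (0 : 'rV[R]_0))%:E
  | m.+1 => fun A =>
      (\int[@lebesgue_measure R]_x
         volume [set y : 'rV[R]_m | A (row_mx (x%:M : 'rV[R]_1) y)])%E
  end.

Definition center_of_gravity (R : realType) (n : nat)
    (v : 'I_n.+1 -> 'rV[R]_n) : 'rV[R]_n :=
  n.+1%:R^-1 *: \sum_i v i.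

Definition homothety (R : realType) (n : nat) (c : 'rV[R]_n) (sigma : R)
    (x : 'rV[R]_n) : 'rV[R]_n :=
  c + sigma *: (x - c).

Definition dilated_simplex (R : realType) (n : nat) (sigma : R)
    (v : 'I_n.+1 -> 'rV[R]_n) : set 'rV[R]_n :=
  homothety (center_of_gravity v) sigma @` simplex v.

Definition xi (R : realType) (n : nat) (v : 'I_n.+1 -> 'rV[R]_n) : R :=
  set_min [set sigma | 1 <= sigma /\ unit_cube R n `<=` dilated_simplex sigma v].

Definition xi_n (R : realType) (n : nat) : R :=
  set_min [set xi v | v in [set v : 'I_n.+1 -> 'rV[R]_n |
    [/\ affinely_independent v, simplex v `<=` unit_cube R n
      & volume (simplex v) <> 0%E]]].

(* Main.v *)
Require Import Defs.
From mathcomp Require Import all_boot all_order all_algebra.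
From mathcomp Require Import all_classical all_reals all_analysis.
From mathcomp Require Import measurable_realfun.
From mathcomp Require Import lra.

Set Implicit Arguments.
Unset Strict Implicit.
Unset Printing Implicit Defensive.

Import Order.TTheory GRing.Theory Num.Theory.

Local Open Scope ring_scope.

(** Let lambda_j be the barycentric coordinates of a simplex S with vertices
    v_j. They are affine functions, and for sigma >= 1 the dilated simplex
    sigma S is the set where every lambda_j is at least (1 - sigma) / (n + 1).
    An affine function b + sum_i l_i x_i has minimum b + sum_i min (l_i, 0) on
    the cube, so the inclusion of the cube in sigma S amounts to n + 1 linear
    inequalities on sigma (cube_in_dilated); in particular xi is attained
    (xi_attained).

    Lower bound, in every dimension n (dim_le_dilation). Let l_ji be the slope
    of lambda_j in direction i. Differentiating sum_j lambda_j = 1 and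
    x = sum_j lambda_j(x) v_j gives sum_j l_ji = 0 and sum_j l_ji v_ji = 1 for
    each i. As the v_ji lie in [0,1], the positive slopes in direction i sum to
    at least 1, hence the negative ones sum to at most -1. Adding up the n + 1
    inequalities above yields 1 - sigma <= 1 - n, that is, n <= sigma.

    Equality for n = 5. The six points extremal_vertex form a simplex in the
    cube whose center of gravity is the center of the cube and whose
    barycentric coordinates all have minimum -2/3 = (1 - 5) / 6 on the cube, so
    that sigma = 5 is enough (xi_extremal). This simplex contains a small box,
    hence has nonzero volume (volume_of_box, extremal_volume). *)

(** * Minima of sets *)

Lemma set_min_eq (R : realType) (A : set R) (m : R) :
  A m -> lbound A m -> set_min A = m.
Proof.
move=> Am lbm; apply: xget_unique; first by split.
move=> y [Ay lby]; apply/eqP; rewrite eq_le.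
by rewrite (lby _ Am) (lbm _ Ay).
Qed.

(** * Volume of a set containing a box *)

(** The slice volumes of an arbitrary set may form a non-measurable function, so
    monotonicity is taken from the definition of the integral as a supremum: a
    simple function below f is also below g. *)
Lemma nonneg_integral_mono d (T : measurableType d) (R : realType)
    (mu : {measure set T -> \bar R}) (f g : T -> \bar R) :
  (forall x, 0 <= f x)%E -> (forall x, f x <= g x)%E ->
  (\int[mu]_x f x <= \int[mu]_x g x)%E.
Proof.
move=> f0 fg; rewrite !ge0_integralTE //; last first.
  by move=> x; exact: le_trans (f0 x) (fg x).
apply: ereal_sup_le => _ [h /= hf <-]; exists h => // x.
exact: le_trans (hf x) (fg x).
Qed.

Lemma volume_ge0 (R : realType) (n : nat) (A : set 'rV[R]_n) :
  (0 <= volume A)%E.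
Proof.
elim: n A => [|n IHn] A /=; first by rewrite lee_fin.
by apply: integral_ge0 => x _; exact: IHn.
Qed.

(** Slicing along the first coordinate: for x in an interval of length 2 r the
    slice contains an n-dimensional box, and elsewhere its volume is at least 0,
    so the slice volumes dominate a multiple of an indicator function. *)
Lemma volume_of_box (R : realType) (n : nat) (A : set 'rV[R]_n)
    (c : 'rV[R]_n) (r : R) :
  0 < r ->
  (forall x : 'rV[R]_n, (forall i, `|x ord0 i - c ord0 i| <= r) -> A x) ->
  (((2 * r) ^+ n)%:E <= volume A)%E.
Proof.
move=> r0; elim: n A c => [|n IHn] A c boxA /=.
  rewrite lee_fin expr0 indicE mem_set //.
  by apply: boxA => -[].
pose I : set R := `[c ord0 ord0 - r, c ord0 ord0 + r]%classic.
have mI : measurable I by exact: measurable_itv.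
have muI : lebesgue_measure I = (2 * r)%:E.
  rewrite /I lebesgue_measure_itv /= lte_fin ifT; last lra.
  by rewrite -EFinD; congr EFin; lra.
pose h (x : R) := (((2 * r) ^+ n)%:E * (\1_I x)%:E)%E.
have -> : ((2 * r) ^+ n.+1)%:E = (\int[@lebesgue_measure R]_x h x)%E.
  rewrite ge0_integralZl //; last 2 first.
  - by apply/measurable_EFinP; exact: measurable_indic.
  - by rewrite lee_fin exprn_ge0 // mulr_ge0 // ltW.
  by rewrite integral_indic // setIT exprSr EFinM -muI.
apply: nonneg_integral_mono => [x|x].
  by rewrite /h -EFinM lee_fin mulr_ge0 // exprn_ge0 // mulr_ge0 // ltW.
rewrite /h indicE; case: (boolP (x \in I)) => [|_]; last first.
  by rewrite mule0 volume_ge0.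
rewrite inE /I /= in_itv /= mule1 => /andP[cx xc].
apply: (IHn _ (\row_i c ord0 (lift ord0 i))) => y yc /=.
apply: boxA => i; rewrite !mxE; case: splitP => j ij.
  rewrite (ord1 j) mxE eqxx mulr1n.
  have -> : i = ord0 by apply: val_inj; rewrite /= ij (ord1 j).
  by rewrite ler_norml; apply/andP; split; lra.
have -> : i = lift ord0 j by apply: val_inj; rewrite /= ij.
by have := yc j; rewrite mxE.
Qed.

(** * Barycentric coordinates *)

Definition affine_form (R : realType) (n : nat) (b : R) (l : 'I_n -> R)
  (x : 'rV[R]_n) : R := b + \sum_i l i * x ord0 i.

Definition barycentric (R : realType) (n : nat) (v : 'I_n.+1 -> 'rV[R]_n)
    (b : 'I_n.+1 -> R) (l : 'I_n.+1 -> 'I_n -> R) : Prop :=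
  forall x, \sum_j affine_form (b j) (l j) x = 1
         /\ \sum_j affine_form (b j) (l j) x *: v j = x.

(** Prefixing a 1 to each vertex gives a square matrix V, which affine
    independence makes invertible; the coordinates of x are the entries of
    (1, x) V^-1, and the columns of V^-1 are their coefficients. *)
Lemma barycentric_exists (R : realType) (n : nat)
    (v : 'I_n.+1 -> 'rV[R]_n) :
  affinely_independent v -> exists b l, barycentric v b l.
Proof.
move=> affv.
pose hom (x : 'rV[R]_n) : 'rV[R]_n.+1 :=
  \row_j if unlift ord0 j is Some k then x ord0 k else 1.
pose V : 'M[R]_n.+1 := \matrix_i hom (v i).
have homT x : hom x ord0 ord0 = 1 by rewrite mxE unlift_none.
have homL x k : hom x ord0 (lift ord0 k) = x ord0 k by rewrite mxE liftK.
have mulV (u : 'rV[R]_n.+1) x : u *m V = hom x ->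
    \sum_i u ord0 i = 1 /\ \sum_i u ord0 i *: v i = x.
  move=> uV; split.
    rewrite -(homT x) -uV mxE; apply: eq_bigr => i _.
    by rewrite mxE homT mulr1.
  apply/rowP => k; rewrite -[RHS]homL -uV mxE summxE; apply: eq_bigr => i _.
  by rewrite !mxE liftK.
have Vunit : V \in unitmx.
  rewrite -row_free_unit; apply: inj_row_free => u uV0.
  apply/rowP => j; rewrite mxE; apply: (affv (fun i => u ord0 i)) j.
    have := congr1 (fun M : 'rV_n.+1 => M ord0 ord0) uV0; rewrite !mxE => sum0.
    rewrite -[RHS]sum0; apply: eq_bigr => i _.
    by rewrite mxE homT mulr1.
  apply/rowP => k.
  have := congr1 (fun M : 'rV_n.+1 => M ord0 (lift ord0 k)) uV0.
  rewrite !mxE => comb0; rewrite -[RHS]comb0 summxE; apply: eq_bigr => i _.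
  by rewrite !mxE liftK.
exists (fun j => invmx V ord0 j), (fun j i => invmx V (lift ord0 i) j) => x.
have coordE j :
    affine_form (invmx V ord0 j) (fun i => invmx V (lift ord0 i) j) x
    = (hom x *m invmx V) ord0 j.
  rewrite [RHS]mxE big_ord_recl homT mul1r; congr (_ + _).
  by apply: eq_bigr => i _; rewrite homL mulrC.
have [] := mulV (hom x *m invmx V) x (mulmxKV Vunit (hom x)).
by split; under eq_bigr do rewrite coordE.
Qed.

Lemma barycentric_unique (R : realType) (n : nat) (v : 'I_n.+1 -> 'rV[R]_n)
    (s t : 'I_n.+1 -> R) :
  affinely_independent v -> \sum_i s i = \sum_i t i ->
  \sum_i s i *: v i = \sum_i t i *: v i -> s =1 t.
Proof.
move=> affv sumst combst i; apply/eqP; rewrite -subr_eq0; apply/eqP.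
apply: (affv (fun i => s i - t i)).
  by rewrite sumrB sumst subrr.
by under eq_bigr do rewrite scalerBl; rewrite sumrB combst subrr.
Qed.

(** The homothety acts on barycentric coordinates by
    t |-> 1/(n+1) + sigma (t - 1/(n+1)), which maps t >= 0 onto the half-line
    from (1 - sigma) / (n + 1). *)
Lemma dilated_of_coord_ge (R : realType) (n : nat) (v : 'I_n.+1 -> 'rV[R]_n)
    b l (sigma : R) (x : 'rV[R]_n) :
  barycentric v b l -> 1 <= sigma ->
  (forall j, (1 - sigma) / n.+1%:R <= affine_form (b j) (l j) x) ->
  dilated_simplex sigma v x.
Proof.
move=> vbl s1 ge_coord.
have s0 : 0 < sigma by exact: lt_le_trans s1.
have n0 : n.+1%:R != 0 :> R by rewrite pnatr_eq0.
pose t j := n.+1%:R^-1 + sigma^-1 * (affine_form (b j) (l j) x - n.+1%:R^-1).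
have [sum1 sumx] := vbl x.
exists (\sum_i t i *: v i).
  exists t; split=> // [i|].
    rewrite /t -(pmulr_rge0 _ s0) mulrDr mulVKf ?gt_eqF //.
    by have := ge_coord i; move: (_^-1) (affine_form _ _ _) => N a ?; lra.
  rewrite big_split -mulr_sumr sumrB sum1 /= sumr_const card_ord.
  by rewrite -[_ *+ _]mulr_natl divff // subrr mulr0 addr0.
rewrite /homothety.
have -> : \sum_i t i *: v i
    = center_of_gravity v + sigma^-1 *: (x - center_of_gravity v).
  rewrite /center_of_gravity -[in x - _]sumx scaler_sumr -sumrB scaler_sumr.
  rewrite -big_split; apply: eq_bigr => i _ /=.
  by rewrite -scalerBl scalerA -scalerDl.
rewrite [_ + _ - _]addrAC subrr add0r scalerA divff ?gt_eqF // scale1r.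
by rewrite addrC subrK.
Qed.

Lemma coord_ge_of_dilated (R : realType) (n : nat) (v : 'I_n.+1 -> 'rV[R]_n)
    b l (sigma : R) (x : 'rV[R]_n) :
  affinely_independent v -> barycentric v b l -> 1 <= sigma ->
  dilated_simplex sigma v x ->
  forall j, (1 - sigma) / n.+1%:R <= affine_form (b j) (l j) x.
Proof.
move=> affv vbl s1 [y [t [t0 t1 ->]] <-] j.
have s0 : 0 < sigma by exact: lt_le_trans s1.
have n0 : n.+1%:R != 0 :> R by rewrite pnatr_eq0.
set x' := homothety _ _ _.
pose u j := n.+1%:R^-1 + sigma * (t j - n.+1%:R^-1).
have [sum1 sumx] := vbl x'.
rewrite (barycentric_unique affv (s := fun j => affine_form (b j) (l j) x')
  (t := u)).
- have := mulr_ge0 (ltW s0) (t0 j); rewrite /u.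
  by move: (_^-1) (t j) => N a ?; lra.
- rewrite sum1 big_split -mulr_sumr sumrB t1 /= sumr_const card_ord.
  by rewrite -[_ *+ _]mulr_natl divff // subrr mulr0 addr0.
- rewrite sumx /x' /homothety /center_of_gravity scaler_sumr -sumrB.
  rewrite scaler_sumr -big_split; apply: eq_bigr => i _ /=.
  by rewrite -scalerBl scalerA -scalerDl.
Qed.

(** * Simplices and the cube *)

Lemma simplex_sub_cube (R : realType) (n : nat) (v : 'I_n.+1 -> 'rV[R]_n) :
  (simplex v `<=` unit_cube R n)%classic <-> forall j, unit_cube R n (v j).
Proof.
split=> [sub j|vQ x [t [t0 t1 ->]] i].
  apply: sub; exists (fun k => (k == j)%:R); split=> [k||].
  - exact: ler0n.
  - by rewrite (bigD1 j) //= eqxx big1 ?addr0 // => k /negbTE ->.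
  - rewrite (bigD1 j) //= eqxx scale1r big1 ?addr0 // => k /negbTE ->.
    by rewrite scale0r.
rewrite summxE; apply/andP; split.
  apply: sumr_ge0 => k _; rewrite mxE mulr_ge0 //.
  by have /andP[] := vQ k i.
rewrite -[leRHS]t1; apply: ler_sum => k _; rewrite mxE.
by have /andP[v0 v1] := vQ k i; rewrite ler_piMr.
Qed.

Lemma affine_form_ge_cube (R : realType) (n : nat) (b : R) (l : 'I_n -> R)
    (x : 'rV[R]_n) :
  unit_cube R n x -> b + \sum_i Num.min (l i) 0 <= affine_form b l x.
Proof.
move=> xQ; rewrite lerD2l; apply: ler_sum => i _.
have /andP[x0 x1] := xQ i.
case: (leP (l i) 0) => [l0|l0]; first by nra.
by rewrite mulr_ge0 // ltW.
Qed.

Lemma affine_form_min_cube (R : realType) (n : nat) (b : R) (l : 'I_n -> R) :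
  exists2 x, unit_cube R n x &
    affine_form b l x = b + \sum_i Num.min (l i) 0.
Proof.
exists (\row_i (l i <= 0)%R%:R) => [i|].
  by rewrite mxE ler0n lern1 leq_b1.
congr (_ + _); apply: eq_bigr => i _; rewrite mxE.
by case: (leP (l i) 0) => _; rewrite ?mulr1 ?mulr0.
Qed.

Lemma cube_in_dilated (R : realType) (n : nat) (v : 'I_n.+1 -> 'rV[R]_n)
    b l (sigma : R) :
  affinely_independent v -> barycentric v b l -> 1 <= sigma ->
  (unit_cube R n `<=` dilated_simplex sigma v)%classic <->
  forall j, (1 - sigma) / n.+1%:R <= b j + \sum_i Num.min (l j i) 0.
Proof.
move=> affv vbl s1; split=> [Qsub j|ge_min x xQ].
  have [x xQ <-] := affine_form_min_cube (b j) (l j).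
  exact: coord_ge_of_dilated (Qsub _ xQ) _.
apply: dilated_of_coord_ge vbl s1 _ => j.
exact: le_trans (ge_min j) (affine_form_ge_cube _ _ xQ).
Qed.

(** The inequalities of cube_in_dilated are lower bounds m j on sigma, so the
    least admissible sigma is the maximum of 1 and the m j. *)
Lemma xi_attained (R : realType) (n : nat) (v : 'I_n.+1 -> 'rV[R]_n) :
  affinely_independent v ->
  1 <= xi v /\ (unit_cube R n `<=` dilated_simplex (xi v) v)%classic.
Proof.
move=> affv; have [b [l vbl]] := barycentric_exists affv.
pose m j := 1 - n.+1%:R * (b j + \sum_i Num.min (l j i) 0).
pose s := \big[Num.max/1]_j m j.
have mE sigma j :
    ((1 - sigma) / n.+1%:R <= b j + \sum_i Num.min (l j i) 0) = (m j <= sigma).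
  by rewrite ler_pdivrMr ?ltr0Sn // mulrC lerBlDr addrC -lerBlDr.
have s1 : 1 <= s by exact: bigmax_ge_id.
suff -> : xi v = s.
  split=> //; apply/(cube_in_dilated affv vbl s1) => j.
  by rewrite mE; exact: le_bigmax.
apply: set_min_eq => [|sigma [sigma1 Qsub]].
  split=> //; apply/(cube_in_dilated affv vbl s1) => j.
  by rewrite mE; exact: le_bigmax.
apply/bigmax_leP; split=> // j _; rewrite -mE.
by move/(cube_in_dilated affv vbl sigma1): Qsub.
Qed.

(** The coordinates of the points 0 and e_i recover the coefficients b and l, so
    barycentricity at these points gives sumb, suml and sumlv. *)
Lemma dim_le_dilation (R : realType) (n : nat) (v : 'I_n.+1 -> 'rV[R]_n)
    (sigma : R) :
  affinely_independent v -> (forall j, unit_cube R n (v j)) -> 1 <= sigma ->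
  (unit_cube R n `<=` dilated_simplex sigma v)%classic -> n%:R <= sigma.
Proof.
move=> affv vQ s1; have [b [l vbl]] := barycentric_exists affv.
move/(cube_in_dilated affv vbl s1) => ge_min.
have form0 j : affine_form (b j) (l j) 0 = b j.
  by rewrite /affine_form big1 ?addr0 // => i _; rewrite mxE mulr0.
have formE j i : affine_form (b j) (l j) (delta_mx ord0 i) = b j + l j i.
  rewrite /affine_form (bigD1 i) //= mxE !eqxx mulr1 big1 ?addr0 // => k ki.
  by rewrite mxE (negbTE ki) andbF mulr0.
have sumb : \sum_j b j = 1.
  by have [<- _] := vbl 0; apply: eq_bigr.
have suml i : \sum_j l j i = 0.
  have [] := vbl (delta_mx ord0 i); under eq_bigr do rewrite formE.
  by rewrite big_split /= sumb => /(canRL (addKr _)) ->; rewrite addNr.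
have sumlv i : \sum_j l j i * v j ord0 i = 1.
  have [_] := vbl 0; under eq_bigr do rewrite form0; move=> comb0.
  have [_] := vbl (delta_mx ord0 i).
  under eq_bigr do rewrite formE scalerDl; rewrite big_split /= comb0 add0r.
  move/rowP/(_ i); rewrite summxE mxE !eqxx => comb1; rewrite -[RHS]comb1.
  by apply: eq_bigr => j _; rewrite mxE.
have negpart i : \sum_j Num.min (l j i) 0 <= -1.
  have -> : -1 = \sum_j (l j i - l j i * v j ord0 i).
    by rewrite sumrB suml sumlv sub0r.
  apply: ler_sum => j _ /=; have /andP[v0 v1] := vQ j i.
  by case: (leP (l j i) 0) => l0; nra.
have : \sum_(j < n.+1) (1 - sigma) / n.+1%:R
    <= \sum_j (b j + \sum_i Num.min (l j i) 0) by apply: ler_sum.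
rewrite sumr_const card_ord -[(_ / _) *+ _]mulr_natr divfK ?pnatr_eq0 //.
rewrite big_split /= sumb exchange_big /=.
have : \sum_i \sum_j Num.min (l j i) 0 <= \sum_(i < n) (-1 : R).
  by apply: ler_sum.
rewrite sumrN sumr_const card_ord => ? ?; lra.
Qed.

(** * An extremal simplex in dimension 5 *)

Definition extremal_entry (R : realType) (k i : nat) : R :=
  if (k < 4)%N then if (i < 4)%N then (i != k)%:R else 2^-1
  else if (i < 4)%N then 0 else (k == 5)%:R.

(** With S = e_0 + e_1 + e_2 + e_3, vertex k is S - e_k + e_4 / 2 for k < 4;
    the last two vertices are the ends 0 and e_4 of an edge of the cube. *)
Definition extremal_vertex (R : realType) (k : 'I_6) : 'rV[R]_5 :=
  \row_i extremal_entry R k i.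

(** With s = x_0 + x_1 + x_2 + x_3, the barycentric coordinates of x are
    s/3 - x_j for j < 4, then 1 - s/6 - x_4 and x_4 - s/6. *)
Definition extremal_const (R : realType) (j : 'I_6) : R := (j == 4 :> nat)%:R.

Definition extremal_slope (R : realType) (j : 'I_6) (i : 'I_5) : R :=
  if (j < 4)%N then
    if (i < 4)%N then 3^-1 - (i == j :> nat)%:R else 0
  else if (i < 4)%N then - 6^-1 else if (j == 4 :> nat) then -1 else 1.

Lemma extremal_barycentric (R : realType) :
  barycentric (@extremal_vertex R) (@extremal_const R) (@extremal_slope R).
Proof.
move=> x.
(* Indexing coordinates by nat lets expanded sums reduce to closed terms. *)
pose y k := x ord0 (inord k).
have xE i : x ord0 i = y i by rewrite /y inord_val.
split.
  rewrite /affine_form; under eq_bigr do under eq_bigr do rewrite xE.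
  rewrite !big_ord_recl !big_ord0 /extremal_const /extremal_slope /=.
  lra.
apply/rowP => -[i i5]; rewrite summxE xE /affine_form.
under eq_bigr do under eq_bigr do rewrite xE.
under eq_bigr do rewrite !mxE /=.
rewrite !big_ord_recl !big_ord0.
rewrite /extremal_entry /extremal_const /extremal_slope /=.
by move: i i5 => [|[|[|[|[|]]]]] //= _; lra.
Qed.

Lemma extremal_affinely_independent (R : realType) :
  affinely_independent (@extremal_vertex R).
Proof.
move=> a suma comba; pose c k := a (inord k).
have aE i : a i = c i by rewrite /c inord_val.
have comb i : (i < 5)%N -> \sum_(k < 6) c k * extremal_entry R k i = 0.
  move=> i5; have /rowP/(_ (Ordinal i5)) := comba.
  rewrite summxE mxE => eq0; rewrite -[RHS]eq0.
  by apply: eq_bigr => k _; rewrite !mxE aE.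
have {}suma : \sum_(k < 6) c k = 0.
  by rewrite -[RHS]suma; apply: eq_bigr => k _.
have := (comb 0 isT, comb 1 isT, comb 2 isT, comb 3 isT, comb 4 isT)%N.
move: suma; rewrite !big_ord_recl !big_ord0 /extremal_entry /= /bump /=.
move=> h [[[[h0 h1] h2] h3] h4] [i i6]; rewrite aE /=.
by move: i i6 => [|[|[|[|[|[|]]]]]] //= _; lra.
Qed.

Lemma extremal_sub_cube (R : realType) :
  (simplex (@extremal_vertex R) `<=` unit_cube R 5)%classic.
Proof.
apply/simplex_sub_cube => k i; rewrite mxE /extremal_entry.
case: ifP => _; case: ifP => _; rewrite ?ler0n ?lern1 ?leq_b1 ?lexx ?ler01 //.
by apply/andP; split; lra.
Qed.

(** All barycentric coordinates of the center of the cube are 1/6, and each of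
    them is an affine form whose slopes have absolute values summing to 5/3.
    The radius 1/2 gives the bound -2/3 on the whole cube, which is what the
    coefficient 5 allows; the radius 1/10 gives a box inside the simplex. *)
Lemma extremal_form_ge (R : realType) (r : R) (x : 'rV[R]_5) (j : 'I_6) :
  (forall i, `|x ord0 i - 2^-1| <= r) ->
  6^-1 - 5 / 3 * r <= affine_form (extremal_const R j) (extremal_slope R j) x.
Proof.
move=> xbox; pose y k := x ord0 (inord k).
have xE i : x ord0 i = y i by rewrite /y inord_val.
have ybox k : 2^-1 - r <= y k <= 2^-1 + r by rewrite -ler_distl; exact: xbox.
have /andP[a0 b0] := ybox 0%N; have /andP[a1 b1] := ybox 1%N.
have /andP[a2 b2] := ybox 2%N; have /andP[a3 b3] := ybox 3%N.
have /andP[a4 b4] := ybox 4%N.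
rewrite /affine_form; under eq_bigr do rewrite xE.
rewrite !big_ord_recl !big_ord0 /extremal_const /extremal_slope /=.
case: j => j j6.
by move: j j6 => [|[|[|[|[|[|]]]]]] //= _; rewrite /bump /=; lra.
Qed.

Lemma extremal_volume (R : realType) :
  volume (simplex (@extremal_vertex R)) <> 0%E.
Proof.
have r0 : 0 < 10^-1 :> R by rewrite invr_gt0 ltr0n.
apply/eqP; rewrite gt_eqF //.
apply: (@lt_le_trans _ _ ((2 * 10^-1) ^+ 5)%:E).
  by rewrite lte_fin exprn_gt0 // mulr_gt0.
apply: (volume_of_box (c := const_mx 2^-1)) => // x xbox.
have [sum1 sumx] := extremal_barycentric x.
exists (fun j => affine_form (extremal_const R j) (extremal_slope R j) x).
split=> // j; apply: (le_trans _ (extremal_form_ge (r := 10^-1) j _)).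
  by lra.
by move=> i; have := xbox i; rewrite mxE.
Qed.

Lemma xi_extremal (R : realType) : xi (@extremal_vertex R) = 5.
Proof.
apply: set_min_eq => [|sigma [sigma1 Qsub]].
  split=> [|x xQ]; first by rewrite ler1n.
  apply: dilated_of_coord_ge (@extremal_barycentric R) _ _ => [|j].
    by rewrite ler1n.
  apply: (le_trans _ (extremal_form_ge (r := 2^-1) j _)); first by lra.
  move=> i; rewrite ler_distl; have /andP[x0 x1] := xQ i.
  by apply/andP; split; lra.
apply: dim_le_dilation Qsub => //; first exact: extremal_affinely_independent.
by apply/simplex_sub_cube; exact: extremal_sub_cube.
Qed.

Theorem mainTheorem2 (R : realType) : xi_n R 5 = 5.
Proof.
apply: set_min_eq.
  exists (@extremal_vertex R); last exact: xi_extremal.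
  split; [exact: extremal_affinely_independent | exact: extremal_sub_cube
    | exact: extremal_volume].
move=> _ [v [affv /simplex_sub_cube vQ _] <-].
have [xi1 Qsub] := xi_attained affv.
exact: dim_le_dilation affv vQ xi1 Qsub.
Qed.
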